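(* Let $G$ be a compact Lie group, let $\tau$ be a non-trivial irreducible (finite-dimensional complex) representation of $G$ with real-valued character $\chi^\tau$, and fix a self-inverse conjugacy class of $G$ with representative $\alpha$. Let $(W,W')$ be the pair $W=\chi^\tau(g)$, $W'=\chi^\tau(\alpha' g)$, where $g$ is chosen from Haar measure on $G$ and, independently, $\alpha'$ is chosen uniformly at random from the conjugacy class of $\alpha$. Then $$\mathbb{E}(W'|W) = \left( \frac{\chi^{\tau}(\alpha)}{\dim(\tau)} \right) W.$$
   Context: Haar measure is normalized to be a probability measure. A conjugacy class is self-inverse if it contains the inverse of each of its elements. Choosing $\alpha'$ uniformly from the conjugacy class of $\alpha$ means $\alpha'=h\alpha h^{-1}$ with $h$ Haar distributed on $G$. $\dim(\tau)$ is the dimension of $\tau$, and $\mathbb{E}(A|B)$ is the conditional expectation of $A$ given $B$. *)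

(* Defs.v *)
From HB Require Import structures.
From mathcomp Require Import all_boot all_order all_algebra.
From mathcomp Require Import complex.
From mathcomp Require Import all_classical all_reals all_analysis.
Import Order.TTheory GRing.Theory Num.Theory.
Import numFieldNormedType.Exports.

Set Implicit Arguments.
Unset Strict Implicit.
Unset Printing Implicit Defensive.

Local Open Scope classical_set_scope.
Local Open Scope ring_scope.

(* Measurable types are built on pointed types in the library; the
   distinguished point plays no other role here. *)
HB.structure Definition PreTopologicalGroup :=
  {G of PointedTopological G & Group G}.

HB.mixin Record isTopologicalGroup G & PreTopologicalGroup G := {
  mulg_continuous : continuous (fun x : G * G => (x.1 * x.2)%g) ;
  invg_continuous : continuous (fun x : G => (x^-1)%g) }.

#[short(type="topologicalGroupType")]
HB.structure Definition TopologicalGroup :=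
  {G of PreTopologicalGroup G & isTopologicalGroup G}.

Section Smooth.
Context {R : realType}.

(* C^k on an open set U, by continuous iterated partial derivatives; the values
   of f outside U are irrelevant. *)
Fixpoint Ck_on (k m d : nat) (U : set 'rV[R]_m) (f : 'rV[R]_m -> 'rV[R]_d) :
    Prop :=
  {in U, continuous f} /\
  if k is k'.+1 then
    forall i : 'I_m,
      {in U, forall x, derivable f x (delta_mx 0 i)} /\
      Ck_on k' U (fun x => 'D_(delta_mx 0 i) f x)
  else True.

Definition smooth_on (m d : nat) (U : set 'rV[R]_m)
    (f : 'rV[R]_m -> 'rV[R]_d) : Prop :=
  forall k, Ck_on k U f.

End Smooth.

(* A chart is a homeomorphism from an open subset of G onto an open subset of
   R^d, represented by total functions whose values outside these two sets are
   irrelevant. *)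
Record chart (R : realType) (G : topologicalType) (d : nat) := Chart {
  chart_dom : set G ;
  chart_map : G -> 'rV[R]_d ;
  chart_inv : 'rV[R]_d -> G ;
  chart_dom_open : open chart_dom ;
  chart_img_open : open (chart_map @` chart_dom) ;
  chart_mapK : {in chart_dom, cancel chart_map chart_inv} ;
  chart_map_continuous : {in chart_dom, continuous chart_map} ;
  chart_inv_continuous : {in chart_map @` chart_dom, continuous chart_inv} }.

Section LieGroup.
Context {R : realType}.

Definition chart_img (G : topologicalType) d (c : chart R G d) : set 'rV[R]_d :=
  chart_map c @` chart_dom c.

Definition smooth_atlas (G : topologicalType) d (A : set (chart R G d)) : Prop :=
  (forall x : G, exists2 c, A c & chart_dom c x) /\
  (forall c1 c2, A c1 -> A c2 ->
     smooth_on (chart_map c1 @` (chart_dom c1 `&` chart_dom c2))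
               (chart_map c2 \o chart_inv c1)).

(* Smoothness of multiplication and inversion, read in the charts of A; a point
   of R^d x R^d is encoded as a row vector of size d + d. *)
Definition smooth_mul (G : topologicalGroupType) d (A : set (chart R G d)) :
    Prop :=
  forall c1 c2 c3, A c1 -> A c2 -> A c3 ->
    let m (z : 'rV[R]_(d + d)) : G :=
      (chart_inv c1 (lsubmx z) * chart_inv c2 (rsubmx z))%g in
    smooth_on [set z | [/\ chart_img c1 (lsubmx z), chart_img c2 (rsubmx z)
                         & chart_dom c3 (m z)]]
              (fun z => chart_map c3 (m z)).

Definition smooth_inv (G : topologicalGroupType) d (A : set (chart R G d)) :
    Prop :=
  forall c1 c2, A c1 -> A c2 ->
    let m (z : 'rV[R]_d) : G := ((chart_inv c1 z)^-1)%g in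
    smooth_on [set z | chart_img c1 z /\ chart_dom c2 (m z)]
              (fun z => chart_map c2 (m z)).

End LieGroup.

(* A Lie group has the same dimension at all its points, by translation, hence
   the single d; d = 0 (discrete groups) is allowed. *)
Definition Lie_group (R : realType) (G : topologicalGroupType) : Prop :=
  [/\ hausdorff_space G, @second_countable G
    & exists d (A : set (chart R G d)),
        [/\ smooth_atlas A, smooth_mul A & smooth_inv A]].

Definition borel (G : topologicalGroupType) := g_sigma_algebraType (@open G).

(* Left-invariance characterizes the normalized Haar measure of a compact
   group; regularity is automatic for compact Lie groups. *)
Definition is_haar (R : realType) (G : topologicalGroupType)
    (mu : probability (borel G) R) : Prop :=
  forall (x : G) (A : set (borel G)), measurable A ->
    mu [set (x * y)%g | y in A] = mu A.

(* The topology on complex matrices is the one induced by the modulus, which the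
   library attaches to the regular module R[i]^o. *)
Record representation (R : realType) (G : topologicalGroupType) (n : nat) :=
  Representation {
    repr_map :> G -> 'M[R[i]]_n ;
    repr1 : repr_map 1%g = 1%:M ;
    reprM : forall x y : G, repr_map (x * y)%g = repr_map x *m repr_map y ;
    repr_continuous : continuous (repr_map : G -> 'M[R[i]^o]_n) }.

Section Representations.
Context {R : realType} {G : topologicalGroupType} {n : nat}.
Implicit Type tau : representation R G n.

Definition repr_irreducible tau : Prop :=
  (0 < n)%N /\
  forall U : {vspace 'cV[R[i]]_n},
    (forall (x : G) v, v \in U -> tau x *m v \in U) ->
    U = 0%VS \/ U = fullv.

Definition repr_nontrivial tau : Prop := exists x : G, tau x != 1%:M.

Definition repr_char tau (x : G) : R[i] := \tr (tau x).

Definition real_char tau : Prop := forall x, repr_char tau x \is Num.real.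

(* For characters satisfying real_char, the character as a real function. *)
Definition rchar tau (x : G) : R := complex.Re (repr_char tau x).

End Representations.

Definition conj_class (G : groupType) (a : G) : set G :=
  [set (h * a * h^-1)%g | h in [set: G]].

Definition self_inverse_class (G : groupType) (C : set G) : Prop :=
  forall x, C x -> C (x^-1)%g.

Section RandomElements.
Context {R : realType} {dO : measure_display} {Omega : measurableType dO}.
Variable P : probability Omega R.

Definition independent_RV (d1 d2 : measure_display) (T1 : measurableType d1)
    (T2 : measurableType d2) (X : {RV P >-> T1}) (Y : {RV P >-> T2}) : Prop :=
  forall A B, measurable A -> measurable B ->
    P (X @^-1` A `&` Y @^-1` B) = (P (X @^-1` A) * P (Y @^-1` B))%E.

Definition haar_distributed (G : topologicalGroupType)
    (mu : probability (borel G) R) (g : {RV P >-> borel G}) : Prop :=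
  forall A, measurable A -> distribution P g A = mu A.

(* The law of h a h^-1 for h distributed according to the Haar measure mu. *)
Definition uniform_on_class (G : topologicalGroupType)
    (mu : probability (borel G) R) (a : G) (X : {RV P >-> borel G}) : Prop :=
  forall A, measurable A ->
    distribution P X A = mu [set h : G | A (h * a * h^-1)%g].

(* Y is (a version of) E(X | Z): a sigma(Z)-measurable integrable function with
   the same integrals as X over the events of sigma(Z). *)
Definition is_cond_expectation (d : measure_display) (T : measurableType d)
    (X : Omega -> R) (Z : Omega -> T) (Y : Omega -> R) : Prop :=
  [/\ P.-integrable [set: Omega] (EFin \o X),
      P.-integrable [set: Omega] (EFin \o Y),
      measurable_fun [set: g_sigma_algebra_preimageType Z] Y
    & forall A, g_sigma_algebra_preimage Z A ->
        (\int[P]_(w in A) (Y w)%:E = \int[P]_(w in A) (X w)%:E)%E].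

End RandomElements.

(* Main.v *)
Require Import Defs.
From HB Require Import structures.
From mathcomp Require Import all_boot all_order all_algebra.
From mathcomp Require Import complex.
From mathcomp Require Import all_classical all_reals all_analysis.
From mathcomp Require Import spectral measurable_realfun.
Import Order.TTheory GRing.Theory Num.Theory.
Import numFieldNormedType.Exports.
Local Open Scope classical_set_scope.
Local Open Scope ring_scope.

(* By independence, [W' = tr (tau alpha' * tau g)] averages, given [g], to
   [tr (M * tau g)], where [M] is the mean of [tau (h * alpha * h^-1)] over Haar
   distributed [h]. Left invariance makes [M] commute with [tau], so by Schur's
   lemma [M] is scalar, and its trace is the character of [alpha]. *)

(** * Bounded measurable real functions *)

Section BoundedMeasurable.
Context {R : realType} {d : measure_display} {T : measurableType d}.
Implicit Types f k : T -> R.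

(** Every integrand below lies in this class. It is stable under sums, products and composition with
    measurable maps, and is integrable for any probability, so it settles all integrability side
    conditions. *)
Definition bounded_measurable f : Prop :=
  measurable_fun [set: T] f /\ exists M : R, forall x, `|f x| <= M.

Lemma bounded_measurable_cst (c : R) : bounded_measurable (fun=> c).
Proof. by split; [exact: measurable_cst | exists `|c|]. Qed.

Lemma bounded_measurableD f k : bounded_measurable f -> bounded_measurable k ->
  bounded_measurable (fun x => f x + k x).
Proof.
move=> [mf [M fM]] [mk [N kN]]; split; first exact: measurable_funD.
by exists (M + N) => x; rewrite (le_trans (ler_normD _ _))// lerD.
Qed.

Lemma bounded_measurableN f :
  bounded_measurable f -> bounded_measurable (fun x => - f x).
Proof.
move=> [mf [M fM]]; split; first exact: measurable_funN.
by exists M => x; rewrite normrN.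
Qed.

Lemma bounded_measurableM f k : bounded_measurable f -> bounded_measurable k ->
  bounded_measurable (fun x => f x * k x).
Proof.
move=> [mf [M fM]] [mk [N kN]]; split; first exact: measurable_funM.
by exists (M * N) => x; rewrite normrM ler_pM.
Qed.

Lemma bounded_measurable_indic (A : set T) :
  measurable A -> bounded_measurable \1_A.
Proof.
move=> mA; split; first exact: measurable_indic.
by exists 1 => x; rewrite indicE; case: (x \in A); rewrite /= ?normr1 ?normr0.
Qed.

Lemma bounded_measurable_integrable (mu : probability T R) (f : T -> R) :
  bounded_measurable f -> mu.-integrable [set: T] (EFin \o f).
Proof.
move=> [mf [M fM]]; apply: measurable_bounded_integrable => //.
  by rewrite -ge0_fin_numE// fin_num_measure.
exists M; split; first by rewrite num_real.
by move=> N MN x _ /=; rewrite (le_trans (fM x))// ltW.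
Qed.

End BoundedMeasurable.

(** * Change of variables and independence *)

Lemma bounded_measurable_comp {R : realType} {d1 d2 : measure_display}
    {T1 : measurableType d1} {T2 : measurableType d2} (f : T2 -> R)
    (X : T1 -> T2) :
  measurable_fun [set: T1] X -> bounded_measurable f ->
  bounded_measurable (f \o X).
Proof.
move=> mX [mf [M fM]]; split; first exact: measurableT_comp mf mX.
by exists M => x; exact: fM.
Qed.

Lemma Rintegral_distribution {R : realType} {dO d : measure_display}
    {Omega : measurableType dO} {T : measurableType d} {P : probability Omega R}
    (X : {RV P >-> T}) (mu : probability T R) (f : T -> R) :
  (forall A, measurable A -> distribution P X A = mu A) ->
  bounded_measurable f -> \int[P]_w f (X w) = \int[mu]_x f x.
Proof.
move=> XE bf; rewrite /Rintegral; congr fine.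
rewrite -(@eq_measure_integral _ _ _ _ mu (distribution P X)); last first.
  by move=> A mA _; exact: XE.
rewrite integral_distribution//; first exact/measurable_EFinP/bf.1.
apply: (bounded_measurable_integrable P (f \o X)).
exact: bounded_measurable_comp.
Qed.

Section Independence.
Context {R : realType} {dO d1 d2 : measure_display}
  {Omega : measurableType dO} {T1 : measurableType d1} {T2 : measurableType d2}.
Variable P : probability Omega R.

(** Independence says that the joint law of [(X, Y)] and the product of the two laws agree on
    rectangles, hence everywhere by uniqueness of the product measure. Fubini then splits the
    integral. *)
Lemma Rintegral_indepM (X : {RV P >-> T1}) (Y : {RV P >-> T2})
    (f : T1 -> R) (k : T2 -> R) :
  independent_RV X Y -> bounded_measurable f -> bounded_measurable k ->
  \int[P]_w (f (X w) * k (Y w)) = (\int[P]_w f (X w)) * (\int[P]_w k (Y w)).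
Proof.
move=> XY bf bk.
have mXY : measurable_fun [set: Omega] (fun w => (X w, Y w)).
  exact: measurable_fun_pair.
pose XYm := MeasurableFun.Pack (MeasurableFun.Class
  (isMeasurableFun.Build _ _ _ _ _ mXY)).
pose XYr : {RV P >-> (T1 * T2)%type} := XYm.
pose mu1 : probability T1 R := distribution P X.
pose mu2 : probability T2 R := distribution P Y.
have bh : bounded_measurable (fun z : T1 * T2 => f z.1 * k z.2).
  apply: bounded_measurableM.
    exact: (bounded_measurable_comp f fst measurable_fst).
  exact: (bounded_measurable_comp k snd measurable_snd).
have joint (A : set (T1 * T2)) : measurable A ->
    distribution P XYr A = (mu1 \x mu2)%E A.
  by move=> mA; symmetry; exact: product_measure_unique.
rewrite (Rintegral_distribution X mu1 f)// /Rintegral.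
have ih : (mu1 \x mu2)%E.-integrable setT
    (EFin \o (fun z : T1 * T2 => f z.1 * k z.2)).
  exact: (bounded_measurable_integrable (mu1 \x mu2)%E).
have -> : (\int[P]_w (f (X w) * k (Y w))%:E =
    \int[mu1 \x mu2]_z (f z.1 * k z.2)%:E)%E.
  rewrite (eq_measure_integral (distribution P XYr)); last first.
    by move=> A mA _; exact/esym/joint.
  rewrite integral_distribution//; first by have [/measurable_EFinP] := bh.
  exact: (bounded_measurable_integrable P _
           (bounded_measurable_comp _ _ mXY bh)).
have ik := bounded_measurable_integrable mu2 k bk.
rewrite -integral12_prod_meas1//=.
(* For fixed [x] the factor [f x] leaves the inner integral, which is then a constant for the outer
   one. *)
transitivity (\int[mu1]_x (f x * \int[mu2]_y k y)).
  congr fine; apply: eq_integral => x _; rewrite /fubini_F /=.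
  under eq_integral do rewrite EFinM.
  by rewrite integralZl// EFinM /Rintegral fineK// integrable_fin_num.
rewrite RintegralZr//; last exact: bounded_measurable_integrable.
by rewrite -(Rintegral_distribution Y mu2 k).
Qed.

End Independence.

(** * Integration of complex-valued functions *)

Section ComplexIntegral.
Context {R : realType} {d : measure_display} {T : measurableType d}.
Implicit Types (c : R[i]) (f k : T -> R[i]).

Definition cbounded_measurable f : Prop :=
  bounded_measurable (fun x => complex.Re (f x)) /\
  bounded_measurable (fun x => complex.Im (f x)).

(** Matrix entries of a representation are complex even when its character is real, so the averaging
    takes place in [R[i]]. Linearity over [R[i]] has to be recovered from the two components. *)
Definition cintegral (mu : probability T R) f : R[i] :=
  Complex (\int[mu]_x complex.Re (f x)) (\int[mu]_x complex.Im (f x)).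

Lemma cbounded_measurable_cst c : cbounded_measurable (fun=> c).
Proof. by split; exact: bounded_measurable_cst. Qed.

Lemma cbounded_measurableD f k : cbounded_measurable f ->
  cbounded_measurable k -> cbounded_measurable (fun x => f x + k x).
Proof.
move=> [fr fi] [kr ki]; split; under eq_fun do rewrite raddfD.
  exact: bounded_measurableD.
exact: bounded_measurableD.
Qed.

Let ReM (x y : R[i]) : complex.Re (x * y) =
  complex.Re x * complex.Re y - complex.Im x * complex.Im y.
Proof. by case: x y => [? ?] [? ?]. Qed.

Let ImM (x y : R[i]) : complex.Im (x * y) =
  complex.Re x * complex.Im y + complex.Im x * complex.Re y.
Proof. by case: x y => [? ?] [? ?]. Qed.

Lemma cbounded_measurableM f k : cbounded_measurable f ->
  cbounded_measurable k -> cbounded_measurable (fun x => f x * k x).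
Proof.
move=> [fr fi] [kr ki]; split.
  under eq_fun do rewrite ReM.
  apply: bounded_measurableD; first exact: bounded_measurableM.
  by apply: bounded_measurableN; exact: bounded_measurableM.
under eq_fun do rewrite ImM.
by apply: bounded_measurableD; exact: bounded_measurableM.
Qed.

Lemma cbounded_measurable_sum (I : Type) (r : seq I) (F : I -> T -> R[i]) :
  (forall i, cbounded_measurable (F i)) ->
  cbounded_measurable (fun x => \sum_(i <- r) F i x).
Proof.
move=> bF; elim: r => [|i r IHr].
  under eq_fun do rewrite big_nil; exact: cbounded_measurable_cst.
by under eq_fun do rewrite big_cons; exact: cbounded_measurableD.
Qed.

Variable mu : probability T R.

Let intg (f : T -> R) := @bounded_measurable_integrable _ _ _ mu f.

Lemma eq_cintegral f k : f =1 k -> cintegral mu f = cintegral mu k.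
Proof. by move=> fk; congr cintegral; exact: funext. Qed.

Lemma cintegral_cst c : cintegral mu (fun=> c) = c.
Proof.
rewrite /cintegral !Rintegral_cst//.
by rewrite (congr1 fine (probability_setT mu)) /= !mulr1; case: c.
Qed.

Lemma cintegralD f k : cbounded_measurable f -> cbounded_measurable k ->
  cintegral mu (fun x => f x + k x) = cintegral mu f + cintegral mu k.
Proof.
move=> [fr fi] [kr ki]; apply/eqP; rewrite eq_complex !raddfD/=.
apply/andP; split; apply/eqP; rewrite -RintegralD//; try exact: intg;
  by apply: eq_Rintegral => x _; rewrite raddfD.
Qed.

Lemma cintegralZ c f : cbounded_measurable f ->
  cintegral mu (fun x => c * f x) = c * cintegral mu f.
Proof.
move=> [fr fi]; apply/eqP; rewrite eq_complex ReM ImM/=.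
rewrite -!RintegralZl//; try exact: intg.
have bZ a (h : T -> R) : bounded_measurable h ->
    bounded_measurable (fun x => a * h x).
  by move=> bh; apply: bounded_measurableM => //; exact: bounded_measurable_cst.
rewrite -RintegralB//; try exact/intg/bZ.
rewrite -RintegralD//; try exact/intg/bZ.
by apply/andP; split; apply/eqP; apply: eq_Rintegral => x _;
  rewrite ?ReM ?ImM.
Qed.

Lemma cintegral_sum (I : Type) (r : seq I) (F : I -> T -> R[i]) :
  (forall i, cbounded_measurable (F i)) ->
  cintegral mu (fun x => \sum_(i <- r) F i x) =
  \sum_(i <- r) cintegral mu (F i).
Proof.
move=> bF; elim: r => [|i r IHr].
  rewrite big_nil -[RHS]cintegral_cst.
  by apply: eq_cintegral => x; rewrite big_nil.
rewrite big_cons -IHr -cintegralD//; last exact: cbounded_measurable_sum.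
by apply: eq_cintegral => x; rewrite big_cons.
Qed.

End ComplexIntegral.

Lemma cbounded_measurable_comp {R : realType} {d1 d2 : measure_display}
    {T1 : measurableType d1} {T2 : measurableType d2} (f : T2 -> R[i])
    (X : T1 -> T2) :
  measurable_fun [set: T1] X -> cbounded_measurable f ->
  cbounded_measurable (fun x => f (X x)).
Proof.
move=> mX [fr fi]; split; [move: fr | move: fi].
  exact: bounded_measurable_comp.
exact: bounded_measurable_comp.
Qed.

Lemma cintegral_distribution {R : realType} {dO d : measure_display}
    {Omega : measurableType dO} {T : measurableType d} {P : probability Omega R}
    (X : {RV P >-> T}) (mu : probability T R) (f : T -> R[i]) :
  (forall A, measurable A -> distribution P X A = mu A) ->
  cbounded_measurable f -> cintegral P (fun w => f (X w)) = cintegral mu f.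
Proof.
move=> XE [fr fi]; rewrite /cintegral.
by rewrite (Rintegral_distribution X mu _ XE fr)
  (Rintegral_distribution X mu _ XE fi).
Qed.

(** The real and imaginary parts of the product expand into four real products, and each factors by
    the real case. *)
Lemma cintegral_indepM {R : realType} {dO d1 d2 : measure_display}
    {Omega : measurableType dO} {T1 : measurableType d1}
    {T2 : measurableType d2} {P : probability Omega R}
    (X : {RV P >-> T1}) (Y : {RV P >-> T2}) (f : T1 -> R[i]) (k : T2 -> R[i]) :
  independent_RV X Y -> cbounded_measurable f -> cbounded_measurable k ->
  cintegral P (fun w => f (X w) * k (Y w)) =
  cintegral P (fun w => f (X w)) * cintegral P (fun w => k (Y w)).
Proof.
move=> XY [fr fi] [kr ki].
have mX : measurable_fun [set: Omega] X by [].
have mY : measurable_fun [set: Omega] Y by [].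
have bM (f1 : T1 -> R) (k1 : T2 -> R) : bounded_measurable f1 ->
    bounded_measurable k1 ->
    P.-integrable setT (EFin \o (fun w => f1 (X w) * k1 (Y w))).
  move=> bf1 bk1; apply/bounded_measurable_integrable/bounded_measurableM.
    exact: bounded_measurable_comp _ _ mX bf1.
  exact: bounded_measurable_comp _ _ mY bk1.
apply/eqP; rewrite eq_complex; apply/andP; split; apply/eqP => /=.
  rewrite -(Rintegral_indepM P X Y _ _ XY fr kr).
  rewrite -(Rintegral_indepM P X Y _ _ XY fi ki) -RintegralB//;
    try solve [exact: (bM _ _ fr kr) | exact: (bM _ _ fi ki)].
  by apply: eq_Rintegral => w _; case: (f _) (k _) => [? ?] [? ?].
rewrite -(Rintegral_indepM P X Y _ _ XY fr ki).
rewrite -(Rintegral_indepM P X Y _ _ XY fi kr) -RintegralD//;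
  try solve [exact: (bM _ _ fr ki) | exact: (bM _ _ fi kr)].
by apply: eq_Rintegral => w _; case: (f _) (k _) => [? ?] [? ?].
Qed.

(** * Schur's lemma *)

(** Since [R[i]] is algebraically closed and [0 < n], [M] has an eigenvalue [c]. Its eigenspace is
    invariant under [tau] and nonzero, hence the whole space. Taking traces in [M = c%:M] identifies
    [c]. *)
Lemma schur_scalar {R : realType} {G : topologicalGroupType} {n : nat}
    (tau : representation R G n) (M : 'M[R[i]]_n) :
  repr_irreducible tau -> (forall x, tau x *m M = M *m tau x) ->
  M = (\tr M / n%:R)%:M.
Proof.
move=> [n0 irr] MC.
(* Eigenvectors from [eigenvalueP] are row vectors; passing through [M^T] produces a column
   eigenvector of [M]. *)
have [c /eigenvalueP[v vM v0]] := eigenvalue_closed M^T n0.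
have Mv : M *m v^T = c *: v^T by rewrite -[M]trmxK -trmx_mul vM linearZ.
pose U := lker (linfun (mulmx (M - c%:M) : 'cV[R[i]]_n -> 'cV[R[i]]_n)).
have UP u : (u \in U) = (M *m u == c *: u).
  by rewrite memv_ker lfunE /= mulmxBl mul_scalar_mx subr_eq0.
have [U0|UT] : U = 0%VS \/ U = fullv.
- apply: irr => x u; rewrite !UP => /eqP Mu.
  by rewrite mulmxA -MC -mulmxA Mu -scalemxAr.
- have : v^T \in U by rewrite UP Mv.
  by rewrite U0 memv0 trmx_eq0 (negPf v0).
have Mc : M = c%:M.
  (* The [j]-th basis vector lies in the eigenspace, which determines column [j] of [M]. *)
  apply/matrixP => i j; have := memvf (delta_mx j 0 : 'cV[R[i]]_n).
  rewrite -UT UP => /eqP /matrixP /(_ i 0).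
  by rewrite -colE !mxE /= eqxx andbT mulr_natr.
by rewrite {1}Mc Mc mxtrace_scalar -[c *+ n]mulr_natr mulfK// pnatr_eq0 -lt0n.
Qed.

(** * Continuity and Borel measurability *)

Lemma continuous_bounded_measurable {R : realType} {G : topologicalGroupType}
    (f : G -> R) :
  compact [set: G] -> continuous f -> bounded_measurable (f : borel G -> R).
Proof.
move=> cG cf; split.
  apply: (measurability _ (RGenOpens.measurableE R)).
  move=> _ [_ [a [b ->] <-]]; rewrite setTI; apply: sub_sigma_algebra.
  by move/continuousP : cf; apply; exact: interval_open.
have /compact_bounded[M [_ fM]] : compact (f @` [set: G]).
  by apply: continuous_compact => //; exact: continuous_subspaceT.
(* [fM] provides a bound for every real strictly above [M], hence the choice [M + 1]. *)
by exists (M + 1) => x; apply: fM; [rewrite ltrDl | exists x].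
Qed.

Lemma continuous_borel_measurable {G : topologicalGroupType} (f : G -> G) :
  continuous f ->
  measurable_fun [set: borel G] (f : borel G -> borel G).
Proof.
move=> /continuousP cf.
have borelE : @measurable _ (borel G) = <<s @open G >> by [].
apply: (measurability _ borelE).
by move=> _ [A oA <-]; rewrite setTI; apply: sub_sigma_algebra; exact: cf.
Qed.

(** Maps are composed as continuous maps, and measurability is derived only at the end. This way the
    Borel sigma-algebra of [G * G] is never compared with the product of the Borel
    sigma-algebras. *)
Lemma conjugation_measurable {G : topologicalGroupType} (a : G) :
  measurable_fun [set: borel G] (fun h : borel G => (h * a * h^-1)%g : borel G).
Proof.
apply: continuous_borel_measurable => x.
have mulc (f k : G -> G) : {for x, continuous f} -> {for x, continuous k} ->
    {for x, continuous (fun h => (f h * k h)%g)}.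
  move=> cf ck; apply: (@continuous_comp _ _ _ (fun h => (f h, k h))
    (fun z : G * G => (z.1 * z.2)%g) x); last exact: mulg_continuous.
  exact: cvg_pair.
apply: (mulc (fun h => h * a)%g (fun h => h^-1)%g); last exact: invg_continuous.
by apply: (mulc id (fun=> a)); [exact: cvg_id | exact: cvg_cst].
Qed.

Lemma Re_continuous {R : realType} :
  continuous (@complex.Re R : R[i]^o -> R).
Proof.
(* Balls of [R[i]^o] have radii in [R[i]], so the real radius [e] is embedded there; it works
   because the real part is bounded by the modulus. *)
move=> z A [e /= e0 eA]; exists (real_complex R e); first by rewrite /= ltcR.
move=> t /= zt; apply: eA => /=; rewrite -ltcR (le_lt_trans _ zt)//.
rewrite normc_def lecR -raddfB -sqrtr_sqr ler_sqrt ?addr_ge0 ?sqr_ge0//.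
by rewrite lerDl sqr_ge0.
Qed.

Lemma Im_continuous {R : realType} :
  continuous (@complex.Im R : R[i]^o -> R).
Proof.
move=> z A [e /= e0 eA]; exists (real_complex R e); first by rewrite /= ltcR.
move=> t /= zt; apply: eA => /=; rewrite -ltcR (le_lt_trans _ zt)//.
rewrite normc_def lecR -raddfB -sqrtr_sqr ler_sqrt ?addr_ge0 ?sqr_ge0//.
by rewrite lerDr sqr_ge0.
Qed.

(** * Haar averages of a representation over a conjugacy class *)

Section RepresentationIntegrals.
Context {R : realType} {G : topologicalGroupType} {n : nat}.
Variable tau : representation R G n.
Hypothesis cG : compact [set: G].

Lemma repr_entry_bounded_measurable (i j : 'I_n) :
  cbounded_measurable (fun x : borel G => tau x i j).
Proof.
have ct : continuous (fun x : G => tau x i j : R[i]^o).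
  move=> x; apply: (@continuous_comp _ _ _ (tau : G -> 'M[R[i]^o]_n)
    (fun M : 'M[R[i]^o]_n => M i j) x); first exact: repr_continuous.
  exact: coord_continuous.
split; apply: continuous_bounded_measurable => // x.
  by apply: (continuous_comp (ct x)); exact: Re_continuous.
by apply: (continuous_comp (ct x)); exact: Im_continuous.
Qed.

Variables (mu : probability (borel G) R) (a : G).

Definition conjugation_average : 'M[R[i]]_n :=
  \matrix_(i, j) cintegral mu (fun h : borel G => tau (h * a * h^-1)%g i j).

Let conj_entry i j :
  cbounded_measurable (fun h : borel G => tau (h * a * h^-1)%g i j).
Proof.
exact: (cbounded_measurable_comp _ _ (conjugation_measurable a)
  (repr_entry_bounded_measurable i j)).
Qed.

Lemma repr_char_bounded_measurable :
  cbounded_measurable (repr_char tau : borel G -> R[i]).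
Proof.
by apply: cbounded_measurable_sum => i; exact: repr_entry_bounded_measurable.
Qed.

Lemma repr_charJ (h : G) : repr_char tau (h * a * h^-1)%g = repr_char tau a.
Proof.
rewrite /repr_char reprM mxtrace_mulC -reprM.
by rewrite mulgA mulVg mul1g.
Qed.

(** The trace passes under the integral, where the character is constant on the conjugacy class. *)
Lemma mxtrace_conjugation_average :
  \tr conjugation_average = repr_char tau a.
Proof.
rewrite /mxtrace; under eq_bigr do rewrite mxE.
rewrite -cintegral_sum// -[RHS](cintegral_cst mu).
by apply: eq_cintegral => h; exact: repr_charJ.
Qed.

(** Left translation by [x] is a random variable on the probability space [(G, mu)], and invariance
    says that its law is again [mu]. *)
Lemma cintegral_translate (x : G) (f : borel G -> R[i]) : is_haar mu ->
  cbounded_measurable f ->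
  cintegral mu (fun h : borel G => f (x * h)%g) = cintegral mu f.
Proof.
move=> haar bf.
have mx :
    measurable_fun [set: borel G] (fun h : borel G => (x * h)%g : borel G).
  apply: continuous_borel_measurable => h.
  apply: (@continuous_comp _ _ _ (fun h => (x, h))
    (fun z : G * G => (z.1 * z.2)%g) h); last exact: mulg_continuous.
  by apply: cvg_pair; [exact: cvg_cst | exact: cvg_id].
pose X : {RV mu >-> borel G} := MeasurableFun.Pack (MeasurableFun.Class
  (isMeasurableFun.Build _ _ _ _ _ mx)).
apply: (cintegral_distribution X) => // A mA.
(* [is_haar] speaks of images whereas a law involves preimages: the preimage of [A] under
   translation by [x] is its image under translation by [x^-1]. *)
rewrite -(haar x^-1%g A mA); congr (mu _).
apply/seteqP; split => y /=.
  by move=> Axy; exists (x * y)%g; rewrite // mulgA mulVg mul1g.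
by move=> [z Az <-]; rewrite /= mulgA mulgV mul1g.
Qed.

(* Replacing [h] by [x * h] conjugates the average by [tau x]. *)
Lemma conjugation_average_comm (x : G) : is_haar mu ->
  tau x *m conjugation_average = conjugation_average *m tau x.
Proof.
move=> haar.
suff E : conjugation_average =
    tau x *m conjugation_average *m tau (x^-1)%g.
  by rewrite [in RHS]E -mulmxA -reprM mulVg repr1 mulmx1.
have bsum i k : cbounded_measurable (fun h : borel G =>
    \sum_l tau x i l * tau (h * a * h^-1)%g l k).
  apply: cbounded_measurable_sum => l.
  by apply: cbounded_measurableM => //; exact: cbounded_measurable_cst.
apply/matrixP => i j; rewrite [LHS]mxE [RHS]mxE.
rewrite -(cintegral_translate x)//.
(* The constant factors are placed on the left, so that [cintegralZ] can take them out of the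
   integral. *)
transitivity (cintegral mu (fun h : borel G => \sum_k tau (x^-1)%g k j *
    (\sum_l tau x i l * tau (h * a * h^-1)%g l k))).
  apply: eq_cintegral => h.
  have -> : (x * h * a * (x * h)^-1 = x * (h * a * h^-1) * x^-1)%g.
    by rewrite invgM !mulgA.
  rewrite reprM mxE; apply: eq_bigr => k _.
  by rewrite mulrC reprM mxE.
rewrite cintegral_sum => [|k]; last first.
  by apply: cbounded_measurableM => //; exact: cbounded_measurable_cst.
apply: eq_bigr => k _; rewrite cintegralZ// mulrC mxE; congr (_ * _).
rewrite cintegral_sum => [|l]; last first.
  by apply: cbounded_measurableM => //; exact: cbounded_measurable_cst.
by apply: eq_bigr => l _; rewrite cintegralZ// mxE.
Qed.

Lemma conjugation_average_scalar : is_haar mu -> repr_irreducible tau ->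
  conjugation_average = (repr_char tau a / n%:R)%:M.
Proof.
move=> haar irr; rewrite -mxtrace_conjugation_average.
by apply: schur_scalar irr _ => x; exact: conjugation_average_comm.
Qed.

End RepresentationIntegrals.

(** * The character of the random product *)

Lemma repr_charM {R : realType} {G : topologicalGroupType} {n : nat}
    (tau : representation R G n) (x y : G) :
  repr_char tau (x * y)%g = \sum_i \sum_j tau x i j * tau y j i.
Proof. by rewrite /repr_char reprM; apply: eq_bigr => i _; rewrite mxE. Qed.

Section CharacterStep.
Context {R : realType} {G : topologicalGroupType} {n : nat}.
Variables (tau : representation R G n) (mu : probability (borel G) R) (a : G).
Hypotheses (cG : compact [set: G]) (mu_haar : is_haar mu).
Hypothesis tau_irr : repr_irreducible tau.
Context {dO : measure_display} {Omega : measurableType dO}.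
Variables (P : probability Omega R) (g a' : {RV P >-> borel G}).
Hypotheses (a'_unif : uniform_on_class mu a a') (ga' : independent_RV g a').

Let entry := repr_entry_bounded_measurable tau cG.

Let entry_comp (X : {RV P >-> borel G}) i j :
  cbounded_measurable (fun w => tau (X w) i j).
Proof.
have mX : measurable_fun [set: Omega] X by [].
exact: cbounded_measurable_comp _ _ mX (entry i j).
Qed.

(** Expanding the trace leaves products of an entry at [a'] and an entry at [g], so measurability of
    the product [a' * g] itself is never invoked. *)
Lemma repr_char_prod_bounded_measurable :
  cbounded_measurable (fun w => repr_char tau (a' w * g w)%g).
Proof.
under eq_fun do rewrite repr_charM.
apply: cbounded_measurable_sum => i; apply: cbounded_measurable_sum => j.
exact: cbounded_measurableM.
Qed.

(** Two changes of variables: from [P] to the law of [a'], which is the image of [mu] under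
    [h * a * h^-1], and from that image back to [mu]. *)
Lemma cintegral_uniform_on_class i j :
  cintegral P (fun w => tau (a' w) i j) = conjugation_average tau mu a i j.
Proof.
pose C : {RV mu >-> borel G} := MeasurableFun.Pack (MeasurableFun.Class
  (isMeasurableFun.Build _ _ _ _ _ (conjugation_measurable a))).
rewrite mxE.
rewrite (cintegral_distribution a' (distribution mu C) (fun x => tau x i j))//.
by rewrite -(cintegral_distribution C _ (fun x => tau x i j)).
Qed.

(** The conditional expectation given [g], tested against an arbitrary bounded function of [g].
    Independence factors each term of the expanded trace, and the mean of [tau (a' w)] is scalar, so
    only the diagonal terms survive. *)
Lemma cintegral_repr_char_step (k : borel G -> R[i]) :
  cbounded_measurable k ->
  cintegral P (fun w => repr_char tau (a' w * g w)%g * k (g w)) =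
  repr_char tau a / n%:R * cintegral P (fun w => repr_char tau (g w) * k (g w)).
Proof.
move=> bk; have mg : measurable_fun [set: Omega] g by [].
have bkg := cbounded_measurable_comp _ _ mg bk.
have bek i j : cbounded_measurable (fun x : borel G => tau x i j * k x).
  exact: cbounded_measurableM.
have bekg i j : cbounded_measurable (fun w => tau (g w) i j * k (g w)).
  exact: cbounded_measurableM.
have b2 i j :
    cbounded_measurable (fun w => tau (g w) j i * k (g w) * tau (a' w) i j).
  exact: cbounded_measurableM.
have b1 i : cbounded_measurable
    (fun w => \sum_j tau (g w) j i * k (g w) * tau (a' w) i j).
  exact: cbounded_measurable_sum.
(* The factors depending on [g] are grouped first, matching the order of the variables in [ga']. *)
transitivity (cintegral P (fun w =>
    \sum_i \sum_j tau (g w) j i * k (g w) * tau (a' w) i j)).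
  apply: eq_cintegral => w; rewrite repr_charM mulr_suml.
  apply: eq_bigr => i _; rewrite mulr_suml; apply: eq_bigr => j _.
  by rewrite -mulrA mulrC.
rewrite cintegral_sum//.
transitivity (cintegral P (fun w =>
    \sum_i tau (g w) i i * k (g w)) * (repr_char tau a / n%:R)).
  rewrite cintegral_sum// mulr_suml; apply: eq_bigr => i _.
  rewrite cintegral_sum// (bigD1 i)//= big1 => [|j ji].
    rewrite addr0 (cintegral_indepM g a' _ _ ga' (bek i i) (entry i i)).
    rewrite cintegral_uniform_on_class conjugation_average_scalar//.
    by rewrite !mxE eqxx.
  rewrite (cintegral_indepM g a' _ _ ga' (bek j i) (entry i j)).
  rewrite cintegral_uniform_on_class conjugation_average_scalar//.
  by rewrite !mxE eq_sym (negPf ji) mulr0.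
rewrite mulrC; congr (_ * _); apply: eq_cintegral => w.
by rewrite /repr_char /mxtrace mulr_suml.
Qed.

End CharacterStep.

(** * Conditioning on the value of the character *)

Theorem lemma3p2 (R : realType) (G : topologicalGroupType)
    (G_Lie : Lie_group R G) (G_compact : compact [set: G])
    (mu : probability (borel G) R) (mu_haar : is_haar mu)
    (n : nat) (tau : representation R G n)
    (tau_irr : repr_irreducible tau) (tau_nontriv : repr_nontrivial tau)
    (tau_real : real_char tau)
    (alpha : G) (alpha_selfinv : self_inverse_class (conj_class alpha))
    (dO : measure_display) (Omega : measurableType dO)
    (P : probability Omega R) (g alpha' : {RV P >-> borel G})
    (g_haar : haar_distributed mu g)
    (alpha'_unif : uniform_on_class mu alpha alpha')
    (g_alpha'_indep : independent_RV g alpha') :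
  let W : Omega -> R := fun w => rchar tau (g w) in
  let W' : Omega -> R := fun w => rchar tau (alpha' w * g w)%g in
  is_cond_expectation P W' W (fun w => rchar tau alpha / n%:R * W w).
Proof.
move=> W W'.
pose rc := rchar tau alpha / n%:R.
have [mW0 _] := (repr_char_bounded_measurable tau G_compact).1.
have mg : measurable_fun [set: Omega] g by [].
have bW : bounded_measurable W.
  exact: bounded_measurable_comp _ _ mg
    (repr_char_bounded_measurable tau G_compact).1.
have bW' : bounded_measurable W'.
  exact: (repr_char_prod_bounded_measurable tau G_compact P g alpha').1.
have bcW : bounded_measurable (fun w => rc * W w).
  by apply: bounded_measurableM => //; exact: bounded_measurable_cst.
have iW' := bounded_measurable_integrable P _ bW'.
have icW := bounded_measurable_integrable P _ bcW.
split => //.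
  apply: measurable_funM; first exact: measurable_cst.
  (* [W] is measurable for the sigma-algebra that it generates: the preimage of [B] belongs to it
     with [B] as witness. *)
  by move=> _ B mB; exists B.
move=> _ [B mB <-]; rewrite setTI.
have mS : measurable (rchar tau @^-1` B : set (borel G)).
  by rewrite -[X in measurable X]setTI; exact: mW0.
have mA : measurable (W @^-1` B).
  by rewrite -[X in measurable X]setTI; exact: bW.1.
(* [W] is a function of [g], so the indicator of the event that [W] lies in [B] equals [k (g w)], a
   valid test function for [cintegral_repr_char_step]. *)
pose k (x : borel G) : R[i] := real_complex R (\1_(rchar tau @^-1` B) x).
have bk : cbounded_measurable k.
  by split; [exact: bounded_measurable_indic | exact: bounded_measurable_cst].
have restrictE (f : Omega -> R) (z : Omega -> R[i]) :
    (forall w, f w = complex.Re (z w)) ->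
    \int[P]_(w in W @^-1` B) f w =
    complex.Re (cintegral P (fun w => z w * k (g w))).
  move=> fz; rewrite Rintegral_mkcond; apply: eq_Rintegral => w _.
  rewrite patchE /k indicE fz.
  rewrite (_ : (w \in W @^-1` B) = (g w \in rchar tau @^-1` B)); last first.
    by apply/idP/idP; rewrite !inE.
  by case: (g w \in _); rewrite ?rmorph1 ?mulr1 ?rmorph0 ?mulr0.
(* Integrability makes the extended real integral finite, so nothing is lost by [fine]. *)
have fin (f : Omega -> R) : P.-integrable [set: Omega] (EFin \o f) ->
    (\int[P]_(w in W @^-1` B) (f w)%:E = (\int[P]_(w in W @^-1` B) f w)%:E)%E.
  move=> fi; rewrite /Rintegral fineK//; apply: integrable_fin_num => //.
  exact: integrableS fi.
rewrite (fin _ icW) (fin _ iW'); congr (_%:E).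
(* Because the character is real at [alpha], the complex factor is the image of the real number
   [rc]. *)
have rcE : repr_char tau alpha / n%:R = real_complex R rc.
  by rewrite -(RRe_real (tau_real alpha)) /rc rmorphM fmorphV rmorph_nat.
rewrite (restrictE W' (fun w => repr_char tau (alpha' w * g w)%g))//.
rewrite (cintegral_repr_char_step tau mu alpha)// rcE.
(* The factor goes back under the integral, which brings this side to the form of [restrictE]; being
   real, it commutes with taking the real part. *)
rewrite -cintegralZ; last first.
  apply: cbounded_measurableM.
    exact: cbounded_measurable_comp _ _ mg
      (repr_char_bounded_measurable tau G_compact).
  exact: cbounded_measurable_comp _ _ mg bk.
rewrite (restrictE _ (fun w => real_complex R rc * repr_char tau (g w))).
  by congr complex.Re; apply: eq_cintegral => w; rewrite mulrA.
move=> w; rewrite /W /rchar; case: (repr_char tau (g w)) => u v /=.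
by rewrite mul0r subr0.
Qed.
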